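(* Let $L$ be a vector space with two ternary Leibniz brackets $[-,-,-]_1$ and $[-,-,-]_2$, and let $\beta_1,\beta_2:L\to L$ be two commuting injective linear maps such that $\beta_1$ is an averaging operator on $(L,[-,-,-]_1)$ and $\beta_2$ is an averaging operator on $(L,[-,-,-]_2)$. Suppose that $$[\beta_1(x),\beta_1(y),\beta_1(z)]_1=[\beta_2(x),\beta_2(y),\beta_2(z)]_2$$ for all $x,y,z\in L$. Then $(L,[-,-,-]_{\beta_1},[-,-,-]_{\beta_2})$ is a compatible ternary Leibniz algebra, where $[x,y,z]_{\beta_i}:=[\beta_i(x),\beta_i(y),z]_i$ for $i=1,2$.
   Context: Vector spaces are over a field $\mathbb{K}$. A ternary Leibniz algebra is a vector space $L$ with a trilinear map (a ternary Leibniz bracket) $[-,-,-]:L\times L\times L\to L$ such that $[[x,y,z],t,u]=[x,y,[z,t,u]]+[x,[y,t,u],z]+[[x,t,u],y,z]$ for all $x,y,z,t,u\in L$. A compatible ternary Leibniz algebra is a triple $(L,[-,-,-]_1,[-,-,-]_2)$ where both $(L,[-,-,-]_1)$ and $(L,[-,-,-]_2)$ are ternary Leibniz algebras and for all $x,y,z,t,u\in L$ $$[[x,y,z]_1,t,u]_2+[[x,y,z]_2,t,u]_1=[x,y,[z,t,u]_1]_2+[x,y,[z,t,u]_2]_1+[x,[y,t,u]_1,z]_2+[x,[y,t,u]_2,z]_1+[[x,t,u]_1,y,z]_2+[[x,t,u]_2,y,z]_1.$$ An averaging operator on a ternary Leibniz algebra $L$ is a linear map $\beta:L\to L$ such that for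 all $x,y,z\in L$ $$\beta([\beta(x),\beta(y),z])=\beta([\beta(x),y,\beta(z)])=\beta([x,\beta(y),\beta(z)])=[\beta(x),\beta(y),\beta(z)].$$ *)

(* Defs.v *)
From HB Require Import structures.
From mathcomp Require Import all_boot all_algebra.
Set Implicit Arguments.
Unset Strict Implicit.
Unset Printing Implicit Defensive.
Import GRing.Theory.
Local Open Scope ring_scope.

Definition trilinear (K : fieldType) (L : lmodType K) (br : L -> L -> L -> L)
    : Prop :=
  [/\ forall y z, linear (fun x => br x y z),
      forall x z, linear (fun y => br x y z)
    & forall x y, linear (fun z => br x y z)].

Definition leibniz_identity (K : fieldType) (L : lmodType K)
    (br : L -> L -> L -> L) : Prop :=
  forall x y z t u : L,
    br (br x y z) t u
    = br x y (br z t u) + br x (br y t u) z + br (br x t u) y z.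

Definition ternary_leibniz (K : fieldType) (L : lmodType K)
    (br : L -> L -> L -> L) : Prop :=
  trilinear br /\ leibniz_identity br.

Definition compatible_ternary_leibniz (K : fieldType) (L : lmodType K)
    (br1 br2 : L -> L -> L -> L) : Prop :=
  [/\ ternary_leibniz br1, ternary_leibniz br2
    & forall x y z t u : L,
        br2 (br1 x y z) t u + br1 (br2 x y z) t u
        = br2 x y (br1 z t u) + br1 x y (br2 z t u)
          + br2 x (br1 y t u) z + br1 x (br2 y t u) z
          + br2 (br1 x t u) y z + br1 (br2 x t u) y z].

Definition averaging_operator (K : fieldType) (L : lmodType K)
    (br : L -> L -> L -> L) (beta : {linear L -> L}) : Prop :=
  forall x y z : L,
    [/\ beta (br (beta x) (beta y) z) = beta (br (beta x) y (beta z)),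
        beta (br (beta x) y (beta z)) = beta (br x (beta y) (beta z))
      & beta (br x (beta y) (beta z)) = br (beta x) (beta y) (beta z)].

Definition twisted_bracket (K : fieldType) (L : lmodType K)
    (br : L -> L -> L -> L) (beta : {linear L -> L}) : L -> L -> L -> L :=
  fun x y z => br (beta x) (beta y) z.

(* Main.v *)
Require Import Defs.
From HB Require Import structures.
From mathcomp Require Import all_boot all_algebra.
Set Implicit Arguments.
Unset Strict Implicit.
Unset Printing Implicit Defensive.
Import GRing.Theory.
Local Open Scope ring_scope.

(** Write [{x,y,z}_i] for the twisted bracket [[beta_i x, beta_i y, z]_i].

    Cancelling the outer injective [beta_i] in the averaging identities shows
    that it does not matter which two of the three slots carry [beta_i],
    [[beta x, beta y, z] = [beta x, y, beta z] = [x, beta y, beta z]], so the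
    Leibniz identity of [[-,-,-]_i] at [beta_i x, beta_i y, beta_i z, beta_i t, u]
    is the Leibniz identity of [{-,-,-}_i] (lemma [twisted_ternary_leibniz]).

    For compatibility, the averaging identities turn the hypothesis relating the
    two structures into [beta_1 {x,y,z}_1 = beta_2 {x,y,z}_2].  Hence
    [beta_1 beta_2] sends each mixed term [{.. {..}_1 ..}_2] to
    [beta_1^2 {.. {..}_1 ..}_1] and each [{.. {..}_2 ..}_1] to
    [beta_2^2 {.. {..}_2 ..}_2].  The image of the compatibility identity under
    the injective map [beta_1 beta_2] is thus the sum of the two Leibniz
    identities, transported by [beta_1^2] and [beta_2^2] respectively (lemma
    [leibniz_compatible_of_intertwined]). *)

Lemma twisted_trilinear (K : fieldType) (L : lmodType K)
    (br : L -> L -> L -> L) (beta : {linear L -> L}) :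
  trilinear br -> trilinear (twisted_bracket br beta).
Proof.
rewrite /twisted_bracket => -[lin_x lin_y lin_z].
split=> [y z | x z | x y] a u v; first by rewrite linearP lin_x.
- by rewrite linearP lin_y.
- by rewrite lin_z.
Qed.

Lemma averaging_shift (K : fieldType) (L : lmodType K)
    (br : L -> L -> L -> L) (beta : {linear L -> L}) :
    injective beta -> averaging_operator br beta ->
  forall x y z,
    br (beta x) (beta y) z = br (beta x) y (beta z) /\
    br (beta x) (beta y) z = br x (beta y) (beta z).
Proof.
move=> inj_beta avg x y z; have [e12 e23 _] := avg x y z.
by split; apply: inj_beta; rewrite e12 // e23.
Qed.

Lemma averaging_morph (K : fieldType) (L : lmodType K)
    (br : L -> L -> L -> L) (beta : {linear L -> L}) :
    averaging_operator br beta ->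
  forall x y z,
    beta (twisted_bracket br beta x y z) = br (beta x) (beta y) (beta z).
Proof. by move=> avg x y z; have [e12 e23 e3] := avg x y z; rewrite e12 e23. Qed.

(** Expanding [beta] of the inner bracket on the left gives an instance of the
    Leibniz identity of [br]; its last two terms differ from the wanted ones only
    in which slot carries no [beta], which [averaging_shift] corrects. *)
Lemma twisted_ternary_leibniz (K : fieldType) (L : lmodType K)
    (br : L -> L -> L -> L) (beta : {linear L -> L}) :
    ternary_leibniz br -> injective beta -> averaging_operator br beta ->
  ternary_leibniz (twisted_bracket br beta).
Proof.
move=> [tri leib] inj_beta avg; split; first exact: twisted_trilinear.
move=> x y z t u; have shift := averaging_shift inj_beta avg.
rewrite {1}/twisted_bracket (averaging_morph avg) leib.
congr (_ + _ + _).
- by rewrite /twisted_bracket (shift x _ z).1.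
- by rewrite /twisted_bracket (shift _ y z).2.
Qed.

(** The compatibility condition holds because its image under [f \o g] is the
    sum of the [f \o f]-image of the Leibniz identity of [p] and the
    [g \o g]-image of that of [q]. *)
Lemma leibniz_compatible_of_intertwined (K : fieldType) (L : lmodType K)
    (p q : L -> L -> L -> L) (f g : {linear L -> L}) :
    leibniz_identity p -> leibniz_identity q ->
    (forall x, f (g x) = g (f x)) -> injective f -> injective g ->
    (forall x y z, f (p x y z) = g (q x y z)) ->
  forall x y z t u,
    q (p x y z) t u + p (q x y z) t u
    = q x y (p z t u) + p x y (q z t u)
      + q x (p y t u) z + p x (q y t u) z
      + q (p x t u) y z + p (q x t u) y z.
Proof.
move=> leib_p leib_q fgC inj_f inj_g fp_gq x y z t u.
have fg_p a b c : f (g (p a b c)) = g (g (q a b c)) by rewrite fgC fp_gq.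
have fg_q a b c : f (g (q a b c)) = f (f (p a b c)) by rewrite fp_gq.
apply/inj_g/inj_f; rewrite !linearD !fg_p !fg_q leib_p leib_q !linearD.
by rewrite [LHS]addrACA [X in X + _ = _]addrACA !addrA.
Qed.

Theorem proposition3p7 (K : fieldType) (L : lmodType K)
    (br1 br2 : L -> L -> L -> L)
    (hbr1 : ternary_leibniz br1) (hbr2 : ternary_leibniz br2)
    (beta1 beta2 : {linear L -> L})
    (hcomm : forall x : L, beta1 (beta2 x) = beta2 (beta1 x))
    (hinj1 : injective beta1) (hinj2 : injective beta2)
    (havg1 : averaging_operator br1 beta1)
    (havg2 : averaging_operator br2 beta2)
    (heq : forall x y z : L,
        br1 (beta1 x) (beta1 y) (beta1 z) = br2 (beta2 x) (beta2 y) (beta2 z)) :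
  compatible_ternary_leibniz (twisted_bracket br1 beta1)
                             (twisted_bracket br2 beta2).
Proof.
have tl1 := twisted_ternary_leibniz hbr1 hinj1 havg1.
have tl2 := twisted_ternary_leibniz hbr2 hinj2 havg2.
split=> //.
apply: (leibniz_compatible_of_intertwined tl1.2 tl2.2 hcomm hinj1 hinj2).
by move=> x y z; rewrite (averaging_morph havg1) (averaging_morph havg2) heq.
Qed.
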